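(* Let $(X,d)$ be a metric space, let $p\in X$, and let $D=X\setminus\{p\}$. Then for all $x,y\in D$, $$s_D(x,y)\le \frac{e^{\tau_p(x,y)}-1}{4}.$$ Moreover, the inequality is sharp for $D=\mathbb{R}^n\setminus\{0\}$ (that is, $X=\mathbb{R}^n$ with the Euclidean metric, $n\ge 2$, and $p=0$): the constant $\frac14$ cannot be replaced by any smaller constant.
   Context: For a metric space $(X,d)$ and $p\in X$, the scale-invariant Cassinian metric on $X\setminus\{p\}$ is $$\tau_p(x,y)=\log\left(1+2\frac{d(x,y)}{\sqrt{d(x,p)\,d(y,p)}}\right),\quad x,y\in X\setminus\{p\}.$$ The triangular ratio metric is $s_D(x,y)=\sup_{q\in\partial D}\frac{d(x,y)}{d(x,q)+d(y,q)}$; for $D=X\setminus\{p\}$ the boundary is $\partial D=\{p\}$, so $$s_D(x,y)=\frac{d(x,y)}{d(x,p)+d(y,p)},\quad x,y\in D.$$ *)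

(* Defs.v *)
From HB Require Import structures.
From mathcomp Require Import all_boot all_order all_algebra.
From mathcomp Require Import all_classical all_reals all_analysis.
From mathcomp Require Import ring lra.

Set Implicit Arguments.
Unset Strict Implicit.
Unset Printing Implicit Defensive.

Import Order.TTheory GRing.Theory Num.Theory.
Import numFieldNormedType.Exports.

Local Open Scope classical_set_scope.
Local Open Scope ring_scope.

(* For p <> x, y the radicand is positive; no junk value is reached there. *)
Definition cassinian {R : realType} {X : metricType R} (p x y : X) : R :=
  ln (1 + 2 * (mdist x y / Num.sqrt (mdist x p * mdist y p))).

(* [B] plays the role of the boundary of the domain D. *)
Definition triangular_ratio {R : realType} {X : metricType R} (B : set X)
    (x y : X) : R :=
  sup [set mdist x y / (mdist x q + mdist y q) | q in B].

(* s_D for D = X \ {p}, with the convention that the boundary of D is {p} for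
   every p.  When p is isolated its topological boundary is empty instead;
   otherwise the two agree, see [frontier_punctured]. *)
Definition punctured_ratio {R : realType} {X : metricType R} (p : X) :
    X -> X -> R :=
  triangular_ratio [set p].

Lemma punctured_ratioE {R : realType} {X : metricType R} (p x y : X) :
  punctured_ratio p x y = mdist x y / (mdist x p + mdist y p).
Proof. by rewrite /punctured_ratio /triangular_ratio image_set1 sup1. Qed.

Lemma frontier_punctured {R : realType} {X : metricType R} (p : X) :
  limit_point [set: X] p ->
  closure (~` [set p]) `\` interior (~` [set p]) = [set p].
Proof.
move=> lp; have op : open (~` [set p]).
  by rewrite openC; apply/accessible_closed_set1/hausdorff_accessible/metric_hausdorff.
rewrite (interior_id _).1 //; apply/seteqP; split=> [x [_ /=]|x ->].
  by move/contrapT.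
split=> [U /lp[y [/eqP yp _ Uy]]|]; first by exists y.
by move=> /=; apply.
Qed.

(* The library's metric on ['rV[R]_n] comes from the sup norm, hence the alias
   carrying the Euclidean one. *)
Definition euclidean (R : realType) (n : nat) : Type := 'rV[R]_n.

HB.instance Definition _ (R : realType) (n : nat) :=
  GRing.Zmodule.on (euclidean R n).

Section euclidean_metric.
Context {R : realType} {n : nat}.
Implicit Types x y z : euclidean R n.

Definition eucl_dist x y : R := Num.sqrt (\sum_(i < n) (x 0 i - y 0 i) ^+ 2).

Let eucl_distxx x : eucl_dist x x = 0.
Proof. by rewrite /eucl_dist big1 ?sqrtr0// => i _; rewrite subrr expr0n. Qed.

Let eucl_dist_positivity x y : eucl_dist x y = 0 -> x = y.
Proof.
move=> /eqP; rewrite sqrtr_eq0 => s0.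
have /eqP : \sum_(i < n) (x 0 i - y 0 i) ^+ 2 = 0.
  by apply/eqP; rewrite eq_le s0 sumr_ge0// => i _; exact: sqr_ge0.
rewrite psumr_eq0 => [/allP h|i _]; last exact: sqr_ge0.
apply/rowP => i; apply/eqP; rewrite -subr_eq0 -sqrf_eq0.
exact/h/mem_index_enum.
Qed.

Let eucl_dist_sym x y : eucl_dist x y = eucl_dist y x.
Proof.
by congr Num.sqrt; apply: eq_bigr => i _; rewrite -sqrrN opprB.
Qed.

Let cauchy_schwarz (a b : 'I_n -> R) :
  (\sum_i a i * b i) ^+ 2 <= (\sum_i a i ^+ 2) * (\sum_i b i ^+ 2).
Proof.
have expand (u v : R) : \sum_i (u * a i - v * b i) ^+ 2 =
    u ^+ 2 * (\sum_i a i ^+ 2) - 2 * u * v * (\sum_i a i * b i)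
    + v ^+ 2 * (\sum_i b i ^+ 2).
  by rewrite !mulr_sumr -sumrB -big_split /=; apply: eq_bigr => i _; ring.
set C := \sum_i a i * b i; set A := \sum_i a i ^+ 2; set B := \sum_i b i ^+ 2.
have B0 : 0 <= B by apply: sumr_ge0 => i _; exact: sqr_ge0.
have [B1|Bn0] := eqVneq B 0.
  have /eqP := B1; rewrite psumr_eq0 => [/allP h|i _]; last exact: sqr_ge0.
  suff -> : C = 0 by rewrite expr0n B1 mulr0.
  apply: big1 => i _; have := h i (mem_index_enum i).
  by rewrite /= sqrf_eq0 => /eqP ->; rewrite mulr0.
have : 0 <= \sum_i (B * a i - C * b i) ^+ 2.
  by apply: sumr_ge0 => i _; exact: sqr_ge0.
rewrite expand -/A -/B -/C.
have -> : B ^+ 2 * A - 2 * B * C * C + C ^+ 2 * B = B * (A * B - C ^+ 2) by ring.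
by rewrite pmulr_rge0 ?lt_def ?Bn0// subr_ge0.
Qed.

Let eucl_dist_triangle y x z : eucl_dist x z <= eucl_dist x y + eucl_dist y z.
Proof.
pose a i := x 0 i - y 0 i; pose b i := y 0 i - z 0 i.
have sq0 (f : 'I_n -> R) : 0 <= \sum_i f i ^+ 2.
  by apply: sumr_ge0 => i _; exact: sqr_ge0.
rewrite -(@ler_pXn2r _ 2) ?nnegrE ?addr_ge0 ?sqrtr_ge0//.
rewrite sqrrD !sqr_sqrtr//.
have -> : \sum_i (x 0 i - z 0 i) ^+ 2 =
    \sum_i a i ^+ 2 + (\sum_i a i * b i) *+ 2 + \sum_i b i ^+ 2.
  rewrite -sumrMnl -!big_split /=; apply: eq_bigr => i _.
  by rewrite /a /b; ring.
rewrite lerD2r lerD2l lerMn2r /=.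
rewrite /eucl_dist -sqrtrM// (le_trans (ler_norm _))// -sqrtr_sqr.
by apply: ler_wsqrtr; exact: cauchy_schwarz.
Qed.

HB.instance Definition _ := isMetric.Build R (euclidean R n)
  eucl_distxx eucl_dist_positivity eucl_dist_sym eucl_dist_triangle.

Lemma euclidean_mdistE x y :
  mdist x y = Num.sqrt (\sum_(i < n) (x 0 i - y 0 i) ^+ 2).
Proof. by []. Qed.

Lemma limit_point_euclidean x : (0 < n)%N -> limit_point [set: euclidean R n] x.
Proof.
move=> n0 U /nbhs_ballP[e /= e0 eU].
pose y : euclidean R n := (x : 'rV_n) - \row_(j < n) (if j == Ordinal n0 then e / 2 else 0).
have xy : mdist x y = e / 2.
  rewrite euclidean_mdistE (bigD1 (Ordinal n0)) //= big1 ?addr0.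
    by rewrite !mxE eqxx opprB addrC subrK sqrtr_sqr ger0_norm// divr_ge0// ltW.
  by move=> j /negbTE j0; rewrite !mxE j0 subr0 subrr expr0n.
exists y; split=> //.
  by rewrite eq_sym -mdist_gt0 xy divr_gt0.
by apply: eU; rewrite ballEmdist /= xy gtr_pMr// invf_lt1 ?ltr1n.
Qed.

End euclidean_metric.

(* Main.v *)
(** Writing a = d(x,p), b = d(y,p), the map t |-> e^t - 1 turns tau_p into
    2 d(x,y) / sqrt(a b), so the inequality is AM-GM, 2 sqrt(a b) <= a + b.
    Equality holds iff x = y or a = b, so antipodal points x, - x of R^n
    attain the constant 1/4. *)
Require Import Defs.
From mathcomp Require Import all_boot all_order all_algebra.
From mathcomp Require Import all_classical all_reals all_analysis.
From mathcomp Require Import ring lra.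

Import Order.TTheory GRing.Theory Num.Theory.
Local Open Scope ring_scope.

Lemma expR_cassinian (R : realType) (X : metricType R) (p x y : X) :
  expR (cassinian p x y) - 1 =
    2 * (mdist x y / Num.sqrt (mdist x p * mdist y p)).
Proof.
rewrite /cassinian lnK; first by rewrite addrC addKr.
rewrite posrE.
(* This also covers [x = p] or [y = p]: the root is then 0, its inverse is 0 by convention, and the
   argument of [ln] is 1. *)
by rewrite ltr_pwDl// mulr_ge0// divr_ge0 ?mdist_ge0 ?sqrtr_ge0.
Qed.

Lemma sqrtr_AGM2 (R : rcfType) (a b : R) : 0 <= a -> 0 <= b ->
  2 * Num.sqrt (a * b) <= a + b.
Proof.
move=> a0 b0; have := sqr_ge0 (Num.sqrt a - Num.sqrt b).
by rewrite sqrrB !sqr_sqrtr// -sqrtrM//; lra.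
Qed.

Lemma punctured_ratio_le (R : realType) (X : metricType R) (p x y : X) :
  x != p -> y != p ->
  punctured_ratio p x y <= (expR (cassinian p x y) - 1) / 4.
Proof.
rewrite -!mdist_gt0 => xp yp; rewrite punctured_ratioE expR_cassinian.
set s := Num.sqrt _; have s0 : 0 < s by rewrite sqrtr_gt0 mulr_gt0.
have -> : 2 * (mdist x y / s) / 4 = mdist x y / (2 * s).
  by field; rewrite gt_eqF.
(* With the common numerator [mdist x y], only the denominators remain to compare. *)
rewrite ler_wpM2l ?mdist_ge0// lef_pV2 ?posrE ?addr_gt0 ?mulr_gt0//.
exact: sqrtr_AGM2 (ltW xp) (ltW yp).
Qed.

Section antipodal.
Context {R : realType} {n : nat}.
Implicit Type x : euclidean R n.

Local Notation o := (0 : euclidean R n).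

Lemma mdist_opp0 x : mdist (- x : euclidean R n) o = mdist x o.
Proof.
by rewrite !euclidean_mdistE; congr Num.sqrt; apply: eq_bigr => i _;
  rewrite !mxE !subr0 sqrrN.
Qed.

Lemma mdist_opp x : mdist x (- x : euclidean R n) = 2 * mdist x o.
Proof.
(* Writing 2 as the root of [2 ^+ 2] brings it under the root, where the sums agree termwise. *)
rewrite !euclidean_mdistE -[2 in RHS]ger0_norm// -sqrtr_sqr -sqrtrM ?sqr_ge0//.
rewrite mulr_sumr; congr Num.sqrt; apply: eq_bigr => i _.
by rewrite !mxE; ring.
Qed.

(** The origin is the midpoint of [x] and [- x], so the triangle inequality through it is an
    equality. *)
Lemma punctured_ratio_opp x : x != 0 ->
  punctured_ratio o x (- x : euclidean R n) = 1.
Proof.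
rewrite -mdist_gt0 => x0; rewrite punctured_ratioE mdist_opp0 mdist_opp.
by field; rewrite gt_eqF ?addr_gt0.
Qed.

Lemma expR_cassinian_opp x : x != 0 ->
  expR (cassinian o x (- x : euclidean R n)) - 1 = 4.
Proof.
rewrite -mdist_gt0 => x0; rewrite expR_cassinian mdist_opp0 mdist_opp.
rewrite -expr2 sqrtr_sqr gtr0_norm//.
by field; rewrite gt_eqF.
Qed.

End antipodal.

Theorem theorem3p8 (R : realType) :
  (forall (X : metricType R) (p x y : X), x != p -> y != p ->
     punctured_ratio p x y <= (expR (cassinian p x y) - 1) / 4) /\
  (forall n : nat, (2 <= n)%N -> forall c : R, c < 1 / 4 ->
     exists x y : euclidean R n, [/\ x != 0, y != 0 &
       c * (expR (cassinian (0 : euclidean R n) x y) - 1) < punctured_ratio (0 : euclidean R n) x y]).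
Proof.
split=> [X p x y|n n2 c c4]; first exact: punctured_ratio_le.
(* Any nonzero vector would serve; this one is nonzero at index 0, which exists since [0 < n]. *)
pose x : euclidean R n := const_mx 1.
have x0 : x != 0.
  apply/eqP => /rowP/(_ (Ordinal (ltnW n2))); rewrite !mxE.
  by apply/eqP; rewrite oner_eq0.
exists x, (- x); split; rewrite ?oppr_eq0//.
(* What remains is [c * 4 < 1]. *)
by rewrite expR_cassinian_opp// punctured_ratio_opp//; lra.
Qed.
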